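(* Let $D$ be a positive integer, $1\le p\le2$, $a_1\ge a_2\ge\dots\ge a_D>0$, and $\Gamma=\{\boldsymbol\theta\in\mathbb{R}^D:\sum_{t=1}^D|\theta_t|^p/a_t^p\le1\}$. For $\epsilon>0$ and a positive integer $n$ let $d_l(\Gamma,n,\epsilon)=\max\{d: a_d^p\,n^{\frac{p-2}{2}}\ge192\,\epsilon^2\}$. If there is a test $\psi$ using $n$ samples from each of $\mathcal N(\boldsymbol\theta^1,I_D)$, $\mathcal N(\boldsymbol\theta^2,I_D)$ and $m$ samples from $\mathcal N(\boldsymbol\theta,I_D)$ with $\max_{i\in\{0,1\}}\sup_{H_i}\mathbb P(\psi\ne i)\le1/4$ in the LFHT problem for $\Gamma$ at scale $\epsilon$, then $$m\ge\frac1{\epsilon^2},\qquad n\ge\frac{\sqrt{d_l(\Gamma,n,\epsilon)}}{2\epsilon^2},\qquad mn\ge\frac{d_l(\Gamma,n,\epsilon)}{96\,\epsilon^4}.$$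
   Context: LFHT: unknown $\boldsymbol\theta^1,\boldsymbol\theta^2,\boldsymbol\theta\in\Gamma$ with $\|\boldsymbol\theta^1-\boldsymbol\theta^2\|_2\ge\epsilon$; independent data $\mathbf X$: $n$ i.i.d. samples of $\mathcal N(\boldsymbol\theta^1,I_D)$, $\mathbf Y$: $n$ i.i.d. samples of $\mathcal N(\boldsymbol\theta^2,I_D)$, $\mathbf Z$: $m$ i.i.d. samples of $\mathcal N(\boldsymbol\theta,I_D)$; $H_0:\boldsymbol\theta=\boldsymbol\theta^1$ vs $H_1:\boldsymbol\theta=\boldsymbol\theta^2$; $\psi(\mathbf X,\mathbf Y,\mathbf Z)\in\{0,1\}$ with $\psi=1$ rejecting $H_0$; $\sup_{H_i}$ ranges over all admissible $\boldsymbol\theta^1,\boldsymbol\theta^2$ with $\boldsymbol\theta=\boldsymbol\theta^{i+1}$.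
   Formalization: The formal theorem additionally assumes that Γ contains two points at Euclidean distance at least ε; otherwise the suprema over H_0 and H_1 are over the empty set, any test qualifies, and the bound m ≥ 1/ε² fails. When no d qualifies, d_l is taken to be 0. *)

(* Defs.v *)
From HB Require Import structures.
From mathcomp Require Import all_boot all_order all_algebra.
From mathcomp Require Import all_classical all_reals all_analysis.
From mathcomp Require Import normal_distribution.
Set Implicit Arguments. Unset Strict Implicit. Unset Printing Implicit Defensive.
Import Order.TTheory GRing.Theory Num.Theory.
Local Open Scope classical_set_scope.
Local Open Scope ring_scope.

(* Expectation of f : N.-tuple R -> \bar R under the product measure
   (x_0,...,x_{N-1}) with x_j ~ N(mu j, 1) independent, written as the
   iterated (Tonelli) integral  \int ... \int f dN(mu 0,1) ... dN(mu (N-1),1). *)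
Fixpoint gauss_prod_int {R : realType} (N : nat) :
    (nat -> R) -> (N.-tuple R -> \bar R) -> \bar R :=
  match N with
  | 0 => fun _ f => f [tuple]
  | N'.+1 => fun mu f =>
      (\int[normal_prob (mu 0%N) 1]_x
         @gauss_prod_int R N' (fun j => mu j.+1)
           (fun t : N'.-tuple R => f [tuple of x :: t]))%E
  end.

Definition gauss_prod_prob {R : realType} (N : nat) (mu : nat -> R)
    (A : set (N.-tuple R)) : \bar R :=
  gauss_prod_int mu (fun t => (\1_A t)%:E).

Definition coords {R : realType} (D : nat) (th : 'I_D -> R) : seq R :=
  [seq th k | k <- enum 'I_D].

(* Flattened mean vector of the data (X, Y, Z): n samples of N(th1, I_D),
   then n samples of N(th2, I_D), then m samples of N(th, I_D); the
   coordinate k of sample j sits at position j * D + k. *)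
Definition lfht_mean {R : realType} (D n m : nat) (th1 th2 th : 'I_D -> R)
    : nat -> R :=
  fun i => nth 0 (flatten (nseq n (coords th1) ++ nseq n (coords th2)
                           ++ nseq m (coords th))) i.

Definition norm2 {R : realType} (D : nat) (v : 'I_D -> R) : R :=
  Num.sqrt (\sum_(k < D) v k ^+ 2).

Definition Gamma_set {R : realType} (D : nat) (p : R) (a : 'I_D -> R)
    : set ('I_D -> R) :=
  [set th | \sum_(t < D) (`|th t| `^ p / a t `^ p) <= 1].

(* d_l(Gamma, n, eps) = max { d in {1..D} : a_d^p n^((p-2)/2) >= 192 eps^2 }
   (index d corresponds to t : 'I_D with d = t+1); 0 if the set is empty. *)
Definition d_l {R : realType} (D : nat) (p : R) (a : 'I_D -> R) (n : nat)
    (eps : R) : nat :=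
  \max_(t < D | 192 * eps ^+ 2 <= a t `^ p * (n%:R) `^ ((p - 2) / 2)) t.+1.

(* psi (a measurable test on the flattened data, true = reject H0) solves the
   LFHT problem for Gamma at scale eps with n, m samples and error <= 1/4. *)
Definition lfht_test_ok {R : realType} (D n m : nat) (Gam : set ('I_D -> R))
    (eps : R) (psi : ((n + n + m) * D).-tuple R -> bool) : Prop :=
  measurable [set t | psi t] /\
  forall th1 th2 : 'I_D -> R, Gam th1 -> Gam th2 ->
    eps <= norm2 (fun k => th1 k - th2 k) ->
    (gauss_prod_prob (lfht_mean n m th1 th2 th1) [set t | psi t]
       <= (1 / 4)%:E)%E /\
    (gauss_prod_prob (lfht_mean n m th1 th2 th2) [set t | ~~ psi t]
       <= (1 / 4)%:E)%E.

(* Main.v *)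
(** Relative to N(0, I) every data law has likelihood ratio
    exp (<mu, t> - |mu|^2 / 2), so all integrals that occur are Gaussian
    exponential moments.  A test with both errors at most 1/4 forces the
    Hellinger affinity of any two (mixtures of) data laws to be at most 7/8:
    if g^2 <= Q0 Q1 then 2 g <= 2 Q0 + Q1 / 2, and one integrates this over the
    rejection region and its mirror image over the complement.

    Two single laws at distance eps give m eps^2 >= 1 and 2 n eps^2 >= 1.  For
    the bounds involving the dimension d, split k s <= d coordinates into k
    blocks of s and put one entry +-b, at a uniform position and with a uniform
    sign, in each block.  The two mixtures Q0, Q1 are then products over the
    blocks of q0_j, q1_j, and with qbar_j = (q0_j + q1_j) / 2 the affinity is at
    least 1 - sum_j int (prod_(l != j) qbar_l) (q0_j - q1_j)^2 / (4 qbar_j).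
    Averaging over the sign makes qbar_j bounded below pointwise, so only
    exponential moments remain.  The two choices of the triple
    (theta1, theta2, theta), namely (0, v, 0) against (v, 0, 0) and (v, -v, v)
    against (v, -v, -v), give the bounds on n and on m n. *)

Require Import Defs.
From HB Require Import structures.
From mathcomp Require Import all_boot all_order all_algebra.
From mathcomp Require Import all_classical all_reals all_analysis.
From mathcomp Require Import measurable_realfun normal_distribution.
From mathcomp Require Import ring lra.
Set Implicit Arguments. Unset Strict Implicit. Unset Printing Implicit Defensive.
Import Order.TTheory GRing.Theory Num.Theory.
Local Open Scope classical_set_scope.
Local Open Scope ring_scope.

(** * Iterated Gaussian integrals and change of mean *)

Section gauss_prod_int_theory.
Context {R : realType}.
Implicit Types (mu : nat -> R).

Lemma gauss_prod_int_ge0 N mu (f : N.-tuple R -> \bar R) :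
  (forall t, 0 <= f t)%E -> (0 <= gauss_prod_int mu f)%E.
Proof.
elim: N mu f => [|N IH] mu f f0 //=.
by apply: integral_ge0 => x _; apply: IH => t.
Qed.

Lemma eq_gauss_prod_int N mu (f g : N.-tuple R -> \bar R) :
  f =1 g -> gauss_prod_int mu f = gauss_prod_int mu g.
Proof. by move=> /funext ->. Qed.

(** The parameter space is quantified so that the induction can absorb the first coordinate into it;
    Tonelli then integrates that coordinate out. *)
Lemma measurable_gauss_prod_int_param N :
  forall (d : measure_display) (T : measurableType d) mu
    (f : T -> N.-tuple R -> \bar R),
  (forall x t, 0 <= f x t)%E ->
  measurable_fun [set: T * N.-tuple R] (fun z => f z.1 z.2) ->
  measurable_fun [set: T] (fun x => gauss_prod_int mu (f x)).
Proof.
elim: N => [|N IH] d T mu f f0 mf /=.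
  have mp : measurable_fun [set: T] (fun x : T => (x, [tuple] : 0.-tuple R)).
    by apply: measurable_fun_pair => //; exact: measurable_cst.
  exact: (measurableT_comp mf mp).
pose k (z : T * R) := gauss_prod_int (fun j => mu j.+1)
  (fun t : N.-tuple R => f z.1 [tuple of z.2 :: t]).
have k0 z : (0 <= k z)%E by exact: gauss_prod_int_ge0.
have mk : measurable_fun [set: T * R] k.
  apply: IH => //.
  have mp : measurable_fun [set: T * R * N.-tuple R]
      (fun z => (z.1.1, [tuple of z.1.2 :: z.2] : N.+1.-tuple R)).
    apply: measurable_fun_pair.
      exact: (measurableT_comp measurable_fst).
    apply: measurable_cons => //.
    exact: (measurableT_comp measurable_snd).
  exact: (measurableT_comp mf mp).
exact: (@measurable_fun_fubini_tonelli_F _ _ _ _ _ (normal_prob (mu 0%N) 1) k).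
Qed.

Lemma measurable_tuple_cons N (x : R) (f : N.+1.-tuple R -> \bar R) :
  measurable_fun [set: N.+1.-tuple R] f ->
  measurable_fun [set: N.-tuple R] (fun t => f [tuple of x :: t]).
Proof.
move=> mf.
have mc : measurable_fun [set: N.-tuple R]
    (fun t => [tuple of x :: t] : N.+1.-tuple R).
  by apply: measurable_cons => //; exact: measurable_cst.
exact: (measurableT_comp mf mc).
Qed.

Lemma measurable_gauss_prod_int_cons N mu (f : N.+1.-tuple R -> \bar R) :
  (forall t, 0 <= f t)%E -> measurable_fun [set: N.+1.-tuple R] f ->
  measurable_fun [set: R]
    (fun x => gauss_prod_int mu (fun t : N.-tuple R => f [tuple of x :: t])).
Proof.
move=> f0 mf.
apply: (@measurable_gauss_prod_int_param N _ R mu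
  (fun x t => f [tuple of x :: t])) => //.
have mc : measurable_fun [set: R * N.-tuple R]
    (fun z => [tuple of z.1 :: z.2] : N.+1.-tuple R).
  exact: measurable_cons.
exact: (measurableT_comp mf mc).
Qed.

Lemma gauss_prod_intD N mu (f g : N.-tuple R -> \bar R) :
  (forall t, 0 <= f t)%E -> measurable_fun setT f ->
  (forall t, 0 <= g t)%E -> measurable_fun setT g ->
  gauss_prod_int mu (fun t => f t + g t)%E
    = (gauss_prod_int mu f + gauss_prod_int mu g)%E.
Proof.
elim: N mu f g => [|N IH] mu f g f0 mf g0 mg //=.
rewrite -ge0_integralD//.
- apply: eq_integral => x _; rewrite -IH//; exact: measurable_tuple_cons.
- by move=> x _; exact: gauss_prod_int_ge0.
- exact: measurable_gauss_prod_int_cons.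
- by move=> x _; exact: gauss_prod_int_ge0.
- exact: measurable_gauss_prod_int_cons.
Qed.

Lemma gauss_prod_intZl N mu (k : R) (f : N.-tuple R -> \bar R) : 0 <= k ->
  (forall t, 0 <= f t)%E -> measurable_fun setT f ->
  gauss_prod_int mu (fun t => k%:E * f t)%E = (k%:E * gauss_prod_int mu f)%E.
Proof.
move=> k0; elim: N mu f => [|N IH] mu f f0 mf //=.
rewrite -ge0_integralZl//.
- apply: eq_integral => x _; rewrite -IH//; exact: measurable_tuple_cons.
- exact: measurable_gauss_prod_int_cons.
- by move=> x _; exact: gauss_prod_int_ge0.
Qed.

Lemma le_gauss_prod_int N mu (f g : N.-tuple R -> \bar R) :
  (forall t, 0 <= f t)%E -> measurable_fun setT f -> measurable_fun setT g ->
  (forall t, f t <= g t)%E ->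
  (gauss_prod_int mu f <= gauss_prod_int mu g)%E.
Proof.
elim: N mu f g => [|N IH] mu f g f0 mf mg fg //=.
have g0 t : (0 <= g t)%E by exact: le_trans (f0 t) (fg t).
apply: ge0_le_integral => //.
- by move=> x _; exact: gauss_prod_int_ge0.
- exact: measurable_gauss_prod_int_cons.
- exact: measurable_gauss_prod_int_cons.
- by move=> x _; apply: IH => //; exact: measurable_tuple_cons.
Qed.

Lemma gauss_prod_int1 N mu :
  gauss_prod_int mu (fun _ : N.-tuple R => 1%E) = 1%E.
Proof.
elim: N mu => [//|N IH] mu /=.
under eq_integral do rewrite IH.
rewrite integral_cst// mul1e; exact: (probability_setT (normal_prob (mu 0%N) 1)).
Qed.

(** The Radon-Nikodym derivative and [normal_pdf] have the same integral over every measurable set,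
    hence agree almost everywhere. *)
Lemma integral_normal_prob (m s : R) (f : R -> \bar R) :
  (forall x, 0 <= f x)%E -> measurable_fun setT f ->
  (\int[normal_prob m s]_x f x =
   \int[lebesgue_measure]_x (f x * (normal_pdf m s x)%:E))%E.
Proof.
move=> f0 mf; have dom := normal_prob_dominates m s.
rewrite -(Radon_Nikodym_SigmaFinite.change_of_variables dom)//=.
have mrn : measurable_fun setT
    (Radon_Nikodym_SigmaFinite.f (normal_prob m s) (@lebesgue_measure R)).
  exact: measurable_int (Radon_Nikodym_SigmaFinite.f_integrable dom).
have mpdf : measurable_fun setT (fun x : R => (normal_pdf m s x)%:E).
  by apply/measurable_EFinP; exact: measurable_normal_pdf.
apply: ge0_ae_eq_integral => //.
- exact: emeasurable_funM.
- exact: emeasurable_funM.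
- by move=> x _; rewrite mule_ge0//; exact: Radon_Nikodym_SigmaFinite.f_ge0.
- by move=> x _; rewrite mule_ge0// lee_fin normal_pdf_ge0.
- apply: ae_eqe_mul2l; apply: integral_ae_eq => //=.
  + exact: Radon_Nikodym_SigmaFinite.f_integrable.
  + by move=> E _ mE; rewrite -Radon_Nikodym_SigmaFinite.f_integral.
Qed.

(** Completing the square: the exponential factor is the ratio of the two densities. *)
Lemma integral_normal_prob_shift (m : R) (f : R -> \bar R) :
  (forall x, 0 <= f x)%E -> measurable_fun setT f ->
  (\int[normal_prob m 1]_x f x =
   \int[normal_prob 0 1]_x ((expR (m * x - m ^+ 2 / 2))%:E * f x))%E.
Proof.
move=> f0 mf; rewrite integral_normal_prob//.
have me : measurable_fun setT (fun x : R => (expR (m * x - m ^+ 2 / 2))%:E).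
  apply/measurable_EFinP/measurableT_comp => //.
  by apply: measurable_funB => //; exact: measurable_funM.
rewrite integral_normal_prob//.
- apply: eq_integral => x _; rewrite [(_ * f x)%E]muleC -muleA -EFinM.
  congr (_ * _%:E)%E; rewrite !normal_pdfE ?oner_neq0// mulrCA -expRD.
  by congr (_ * expR _); rewrite expr1n; field.
- by move=> x; rewrite mule_ge0// lee_fin expR_ge0.
- exact: emeasurable_funM.
Qed.

End gauss_prod_int_theory.

(** * Likelihood ratios and their moments under the centred law *)

Section gauss_mean.
Context {R : realType}.
Implicit Types (mu u v : nat -> R).

Definition dot N u v : R := \sum_(i < N) u i * v i.

(* Density of the Gaussian law with mean mu with respect to the centred one. *)
Definition lik N mu (t : N.-tuple R) : R :=
  expR (\sum_(i < N) mu i * tnth t i - dot N mu mu / 2).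

Lemma lik_gt0 N mu (t : N.-tuple R) : 0 < lik mu t.
Proof. exact: expR_gt0. Qed.

Lemma lik_cons N mu (x : R) (t : N.-tuple R) :
  lik mu [tuple of x :: t] =
  expR (mu 0%N * x - mu 0%N ^+ 2 / 2) * lik (fun j => mu j.+1) t.
Proof.
rewrite /lik /dot -expRD !big_ord_recl; congr expR.
rewrite tnth0 (eq_bigr (fun i : 'I_N => mu i.+1 * tnth t i)); last first.
  by move=> i _; rewrite tnthS /bump.
rewrite [X in _ - (_ + X) / 2](eq_bigr (fun i : 'I_N => mu i.+1 * mu i.+1))//.
by rewrite expr2; ring.
Qed.

Lemma measurable_lik N mu : measurable_fun setT (lik mu : N.-tuple R -> R).
Proof.
apply: measurableT_comp => //; apply: measurable_funB => //.
rewrite (_ : (fun t => _) =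
    (fun t : N.-tuple R => \sum_(i <- index_enum 'I_N) mu i * tnth t i))//.
apply: measurable_sum => i; apply: measurable_funM => //.
exact: measurable_tnth.
Qed.

Lemma gauss_prod_int_lik N mu (f : N.-tuple R -> \bar R) :
  (forall t, 0 <= f t)%E -> measurable_fun setT f ->
  gauss_prod_int mu f =
  gauss_prod_int (fun=> 0) (fun t => (lik mu t)%:E * f t)%E.
Proof.
elim: N mu f => [|N IH] mu f f0 mf /=.
  by rewrite /lik /dot !big_ord0 mul0r subrr expR0 mul1e.
rewrite integral_normal_prob_shift//; last 2 first.
- by move=> x; exact: gauss_prod_int_ge0.
- exact: measurable_gauss_prod_int_cons.
apply: eq_integral => x _.
have mfx := measurable_tuple_cons x mf.
rewrite IH// -gauss_prod_intZl ?expR_ge0//.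
- by apply: eq_gauss_prod_int => t; rewrite muleA -EFinM lik_cons.
- by move=> t; rewrite mule_ge0// lee_fin ltW// lik_gt0.
- by apply: emeasurable_funM => //; apply/measurable_EFinP; exact: measurable_lik.
Qed.

(** Bundling measurability, nonnegativity and a finite value lets integrals be combined and compared
    as real numbers. *)
Definition gauss_mean N (f : N.-tuple R -> R) (r : R) : Prop :=
  [/\ measurable_fun setT f, (forall t, 0 <= f t) &
      gauss_prod_int (fun=> 0) (fun t => (f t)%:E) = r%:E].

Lemma gauss_meanD N (f g : N.-tuple R -> R) r s :
  gauss_mean f r -> gauss_mean g s -> gauss_mean (fun t => f t + g t) (r + s).
Proof.
move=> [mf f0 fE] [mg g0 gE]; split.
- exact: measurable_funD.
- by move=> t; rewrite addr_ge0.
- rewrite EFinD -fE -gE -gauss_prod_intD//; exact/measurable_EFinP.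
Qed.

Lemma gauss_meanZ N (k : R) (f : N.-tuple R -> R) r : 0 <= k ->
  gauss_mean f r -> gauss_mean (fun t => k * f t) (k * r).
Proof.
move=> k0 [mf f0 fE]; split.
- exact: measurable_funM.
- by move=> t; rewrite mulr_ge0.
- rewrite EFinM -fE -gauss_prod_intZl//; exact/measurable_EFinP.
Qed.

Lemma eq_gauss_mean N (f g : N.-tuple R -> R) r s :
  f =1 g -> r = s -> gauss_mean f r -> gauss_mean g s.
Proof. by move=> /funext -> ->. Qed.

Lemma gauss_mean_sum N (I : Type) (s : seq I) (P : pred I)
    (f : I -> N.-tuple R -> R) (r : I -> R) :
  (forall i, P i -> gauss_mean (f i) (r i)) ->
  gauss_mean (fun t => \sum_(i <- s | P i) f i t) (\sum_(i <- s | P i) r i).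
Proof.
move=> H; elim: s => [|i s IH].
  apply: (@eq_gauss_mean _ (cst 0) _ 0); last 1 first.
  - split => //.
    have := @gauss_prod_intZl R N (fun=> 0) 0 (fun=> 1%E) (lexx _) (fun=> lee01)
      (measurable_cst _).
    by rewrite gauss_prod_int1 mule1.
  - by move=> t; rewrite big_nil.
  - by rewrite big_nil.
case: (boolP (P i)) => Pi.
  apply: eq_gauss_mean (gauss_meanD (H i Pi) IH).
    by move=> t; rewrite big_cons Pi.
  by rewrite big_cons Pi.
by apply: eq_gauss_mean IH => [t|]; rewrite big_cons (negbTE Pi).
Qed.

Lemma gauss_mean_le N (f g : N.-tuple R -> R) r s :
  gauss_mean f r -> gauss_mean g s -> (forall t, f t <= g t) -> r <= s.
Proof.
move=> [mf f0 fE] [mg g0 gE] fg; rewrite -lee_fin -fE -gE.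
by apply: le_gauss_prod_int => //; exact/measurable_EFinP.
Qed.

Lemma gauss_mean_lik N u : gauss_mean (lik u : N.-tuple R -> R) 1.
Proof.
split; first exact: measurable_lik.
  by move=> t; rewrite ltW// lik_gt0.
have := gauss_prod_int1 N u; rewrite gauss_prod_int_lik// => <-.
by apply: eq_gauss_prod_int => t; rewrite mule1.
Qed.

Lemma dotDl N u v w : dot N (u \+ v) w = dot N u w + dot N v w.
Proof. by rewrite /dot -big_split; apply: eq_bigr => i _; rewrite mulrDl. Qed.

Lemma dotC N u v : dot N u v = dot N v u.
Proof. by apply: eq_bigr => i _; rewrite mulrC. Qed.

Lemma dotDr N u v w : dot N w (u \+ v) = dot N w u + dot N w v.
Proof. by rewrite !(dotC N w) dotDl. Qed.

(** The two normalizations account for all of |u + v|^2 / 2 except the cross term. *)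
Lemma likM N u v (t : N.-tuple R) :
  lik u t * lik v t = expR (dot N u v) * lik (u \+ v) t.
Proof.
rewrite /lik -!expRD; congr expR.
have -> : \sum_(i < N) (u \+ v) i * tnth t i =
    \sum_(i < N) u i * tnth t i + \sum_(i < N) v i * tnth t i.
  by rewrite -big_split; apply: eq_bigr => i _; rewrite /= mulrDl.
by rewrite !dotDl !dotDr (dotC N v u); field.
Qed.

Lemma gauss_mean_lik2 N u v :
  gauss_mean (fun t : N.-tuple R => lik u t * lik v t) (expR (dot N u v)).
Proof.
apply: eq_gauss_mean (gauss_meanZ (expR_ge0 (dot N u v)) (gauss_mean_lik N (u \+ v))).
  by move=> t; rewrite likM.
by rewrite mulr1.
Qed.

(** A factor with mean orthogonal to the other two integrates to 1 independently of them; this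
    removes the blocks not under study. *)
Lemma gauss_mean_lik3 N u v w : dot N u v = 0 -> dot N u w = 0 ->
  gauss_mean (fun t : N.-tuple R => lik u t * (lik v t * lik w t))
    (expR (dot N v w)).
Proof.
move=> uv uw.
apply: eq_gauss_mean (gauss_meanZ (expR_ge0 (dot N v w)) (gauss_mean_lik2 N u (v \+ w))).
  by move=> t; rewrite [lik v t * _]likM mulrCA.
by rewrite dotDr uv uw addr0 expR0 mulr1.
Qed.

Lemma gauss_mean_error N mu (A : set (N.-tuple R)) (b : N.-tuple R -> bool) (e : R) :
  measurable A -> (forall t, A t <-> b t) ->
  (gauss_prod_prob mu A <= e%:E)%E ->
  exists2 r, r <= e & gauss_mean (fun t => (b t)%:R * lik mu t) r.
Proof.
move=> mA Ab.
have bE t : \1_A t = (b t)%:R :> R.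
  by rewrite indicE; congr (nat_of_bool _)%:R; apply/idP/idP; rewrite inE => /Ab.
have m1 : measurable_fun setT (fun t => (\1_A t)%:E : \bar R).
  exact/measurable_EFinP.
have n1 t : (0 <= (\1_A t)%:E :> \bar R)%E by rewrite lee_fin.
rewrite /gauss_prod_prob (gauss_prod_int_lik mu n1 m1).
rewrite (@eq_gauss_prod_int _ _ _ _ (fun t => ((b t)%:R * lik mu t)%:E)); last first.
  by move=> t; rewrite bE mulrC -EFinM mulrC.
set I := gauss_prod_int _ _ => Ie.
have f0 t : 0 <= (b t)%:R * lik mu t by rewrite mulr_ge0// ltW// lik_gt0.
have I0 : (0 <= I)%E by apply: gauss_prod_int_ge0 => t; rewrite lee_fin.
(* The bound [e] makes the integral finite, so [fine] loses nothing. *)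
have Ifin : I \is a fin_num.
  by rewrite ge0_fin_numE// (le_lt_trans Ie)// ltry.
exists (fine I); first by rewrite -lee_fin fineK.
split => //; last by rewrite fineK.
rewrite (_ : (fun _ => _) = (fun t => \1_A t * lik mu t)); last first.
  by apply/funext => t; rewrite bE.
by apply: measurable_funM => //; exact: measurable_lik.
Qed.

End gauss_mean.

(** * Pointwise inequalities between densities *)

Section pointwise.
Context {R : realType}.

(** Arithmetic-geometric mean inequality for [2 * x] and [y / 2], whose product is [x * y]. *)
Lemma ler_sqr_mul (g x y : R) : 0 <= x -> 0 <= y -> g ^+ 2 <= x * y ->
  2 * g <= 2 * x + y / 2.
Proof.
move=> x0 y0 gxy; have [g0|g0] := leP 0 g; last by lra.
rewrite -(@ler_pXn2r _ 2)// ?nnegrE; [|lra|lra].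
have : 0 <= (2 * x - y / 2) ^+ 2 by exact: sqr_ge0.
nra.
Qed.

(** Weierstrass product inequality; the induction also carries that the product lies in [0, 1]. *)
Lemma subr_sum_le_prod (I : Type) (s : seq I) (z : I -> R) :
  (forall i, 0 <= z i <= 1) ->
  1 - \sum_(i <- s) z i <= \prod_(i <- s) (1 - z i).
Proof.
move=> z01.
suff : [/\ 1 - \sum_(i <- s) z i <= \prod_(i <- s) (1 - z i),
    0 <= \prod_(i <- s) (1 - z i) & \prod_(i <- s) (1 - z i) <= 1] by case.
elim: s => [|i s [IH1 IH2 IH3]]; first by rewrite !big_nil subr0.
rewrite !big_cons; have /andP[z0 z1] := z01 i.
split; nra.
Qed.

(* With r_j = (q0_j - q1_j) / (q0_j + q1_j) one has q0_j q1_j = qbar_j^2 (1 - r_j^2),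
   hence sqrt (prod q0 * prod q1) >= prod qbar * (1 - sum_j r_j^2); C bounds
   1 / qbar_j. *)
Lemma prod_hellinger (k : nat) (q0 q1 : 'I_k -> R) (C : R) :
  (forall j, 0 < q0 j) -> (forall j, 0 < q1 j) ->
  (forall j, 1 <= C * ((q0 j + q1 j) / 2)) ->
  2 * \prod_j ((q0 j + q1 j) / 2) <=
  \sum_j (C / 2 * ((\prod_(l | l != j) ((q0 l + q1 l) / 2)) * (q0 j - q1 j) ^+ 2))
  + (2 * \prod_j q0 j + (\prod_j q1 j) / 2).
Proof.
move=> q0p q1p qC.
pose z j := ((q0 j - q1 j) / (q0 j + q1 j)) ^+ 2.
have sp j : 0 < q0 j + q1 j by rewrite addr_gt0.
have z01 j : 0 <= z j <= 1.
  rewrite /z sqr_ge0 expr_div_n ler_pdivrMr ?exprn_gt0// mul1r/=.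
  by have := q0p j; have := q1p j; nra.
set Q := \prod_j ((q0 j + q1 j) / 2).
have Q0 : 0 < Q by apply: prodr_gt0 => j _; rewrite divr_gt0.
have zQ j : 2 * (Q * z j) <=
    C / 2 * ((\prod_(l | l != j) ((q0 l + q1 l) / 2)) * (q0 j - q1 j) ^+ 2).
  rewrite /Q (bigD1 j)//= /z; set P := \prod_(_ | _) _.
  have P0 : 0 <= P by apply: prodr_ge0 => l _; rewrite divr_ge0// ltW.
  rewrite (_ : 2 * _ = (P * (q0 j - q1 j) ^+ 2) * (q0 j + q1 j)^-1); last first.
    by field; rewrite gt_eqF.
  have W : 0 <= P * (q0 j - q1 j) ^+ 2 by apply: mulr_ge0 => //; exact: sqr_ge0.
  rewrite [leRHS]mulrC ler_wpM2l//.
  by rewrite -div1r ler_pdivrMr// mulrAC -mulrA.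
have qz j : q0 j * q1 j = ((q0 j + q1 j) / 2) ^+ 2 * (1 - z j).
  by rewrite /z; field; rewrite gt_eqF.
set S := \sum_j z j.
have QE : (\prod_j q0 j) * (\prod_j q1 j) = Q ^+ 2 * \prod_j (1 - z j).
  by rewrite -big_split/= (eq_bigr _ (fun j _ => qz j)) big_split/= prodrXl.
apply: (@le_trans _ _ (2 * (Q * S) + 2 * (Q * (1 - S)))).
  by rewrite -mulrDr -mulrDr addrCA subrr addr0 mulr1.
apply: lerD.
  by rewrite /S !mulr_sumr; apply: ler_sum => j _.
have [p0 p1] : 0 <= \prod_j q0 j /\ 0 <= \prod_j q1 j.
  by split; apply: prodr_ge0 => j _; rewrite ltW.
(* For [S >= 1] the left side is nonpositive. Otherwise [(1 - S) ^+ 2 <= 1 - S], which is below the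
   product of the [1 - z j], so [Q * (1 - S)] is at most the geometric mean of the two products. *)
have [S1|S1] := leP 1 S.
  apply: (@le_trans _ _ 0); last by rewrite addr_ge0 ?mulr_ge0.
  by rewrite pmulr_rle0// pmulr_rle0// subr_le0.
apply: ler_sqr_mul => //; rewrite QE exprMn ler_wpM2l ?sqr_ge0//.
apply: le_trans (subr_sum_le_prod _ z01).
have S0 : 0 <= S by apply: sumr_ge0 => j _; have /andP[] := z01 j.
by rewrite -/S; nra.
Qed.

End pointwise.

(** * Uniform averages over finite sets *)

Section average.
Context {R : realType}.

Definition avg (S : finType) (f : S -> R) : R := #|S|%:R^-1 * \sum_a f a.

Lemma eq_avg (S : finType) (f g : S -> R) : f =1 g -> avg f = avg g.
Proof. by move=> /funext ->. Qed.

Lemma avg_cst (S : finType) (c : R) : (0 < #|S|)%N -> avg (fun _ : S => c) = c.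
Proof.
move=> S0; rewrite /avg sumr_const -[c *+ _]mulr_natl mulKf// pnatr_eq0.
by rewrite -lt0n.
Qed.

Lemma avgZl (S : finType) c (f : S -> R) : avg (fun a => c * f a) = c * avg f.
Proof. by rewrite /avg -mulr_sumr mulrCA. Qed.

Lemma avgZr (S : finType) c (f : S -> R) : avg (fun a => f a * c) = avg f * c.
Proof. by rewrite /avg -mulr_suml mulrA. Qed.

Lemma avgM (S S' : finType) (f : S -> R) (g : S' -> R) :
  avg f * avg g = avg (fun a => avg (fun b => f a * g b)).
Proof.
by rewrite -avgZr; apply: eq_avg => a; rewrite avgZl.
Qed.

(** Independent uniform choices in each block amount to one uniform choice of the function [w]; this
    turns a product of block mixtures into a mixture. *)
Lemma avg_prod (k : nat) (S : finType) (f : 'I_k -> S -> R) :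
  \prod_j avg (f j) = avg (fun w : {ffun 'I_k -> S} => \prod_j f j (w j)).
Proof.
rewrite /avg big_split/= prodr_const card_ord bigA_distr_bigA/=.
by rewrite card_ffun card_ord natrX exprVn.
Qed.

Lemma avg_gt0 (S : finType) (f : S -> R) : (0 < #|S|)%N ->
  (forall a, 0 < f a) -> 0 < avg f.
Proof.
move=> S0 f0; have /card_gt0P[a0 _] := S0.
rewrite /avg mulr_gt0 ?invr_gt0 ?ltr0n// (bigD1 a0)//= ltr_wpDr//.
by apply: sumr_ge0 => a _; rewrite ltW.
Qed.

Lemma le_avg (S : finType) (f g : S -> R) : (forall a, f a <= g a) -> avg f <= avg g.
Proof. by move=> fg; rewrite /avg ler_wpM2l ?invr_ge0//; apply: ler_sum. Qed.

Lemma avg_pair (S S' : finType) (f : S * S' -> R) :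
  avg f = avg (fun a => avg (fun b => f (a, b))).
Proof.
rewrite /avg card_prod natrM invfM -mulrA -mulr_sumr pair_bigA/=.
by congr (_ * (_ * _)); apply: eq_bigr => -[].
Qed.

Lemma avg_bool (f : bool -> R) : avg f = (f false + f true) / 2.
Proof. by rewrite /avg card_bool big_bool/= mulrC addrC. Qed.

Lemma gauss_mean_avg N (S : finType) (f : S -> N.-tuple R -> R) (r : S -> R) :
  (forall a, gauss_mean (f a) (r a)) ->
  gauss_mean (fun t => avg (fun a => f a t)) (avg r).
Proof.
by move=> H; apply: gauss_meanZ; [rewrite invr_ge0|apply: gauss_mean_sum => a _].
Qed.

End average.

(** * Factorization of likelihoods over orthogonal means *)

Section lik_sum.
Context {R : realType}.

Lemma dot_suml N (I : Type) (s : seq I) (u : I -> nat -> R) v :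
  dot N (fun i => \sum_(j <- s) u j i) v = \sum_(j <- s) dot N (u j) v.
Proof.
rewrite /dot exchange_big/=; apply: eq_bigr => i _.
by rewrite mulr_suml.
Qed.

(** Orthogonality removes the cross terms from the squared norm of the sum. *)
Lemma lik_sum N (k : nat) (u : 'I_k -> nat -> R) (t : N.-tuple R) :
  (forall j l, j != l -> dot N (u j) (u l) = 0) ->
  lik (fun i => \sum_j u j i) t = \prod_j lik (u j) t.
Proof.
move=> orth; rewrite /lik -expR_sum; congr expR.
rewrite sumrB; congr (_ - _).
  by rewrite exchange_big/=; apply: eq_bigr => i _; rewrite mulr_suml.
rewrite dot_suml mulr_suml; apply: eq_bigr => j _; congr (_ / 2).
rewrite dotC dot_suml (bigD1 j)//= big1 ?addr0// => l lj.
exact: orth.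
Qed.

End lik_sum.

(** * Testing between two single laws *)

Section two_point.
Context {R : realType} (N : nat) (psi : N.-tuple R -> bool).

(** [b] is the event of a wrong decision: [psi] for a mean from H0, its negation for a mean from
    H1. *)
Definition error_le (b : N.-tuple R -> bool) (mu : nat -> R) : Prop :=
  exists2 r : R, r <= 1 / 4 & gauss_mean (fun t => (b t)%:R * lik mu t) r.

(** The geometric mean of [lik u] and [lik v] is [c * lik h] with [h] the midpoint, so the
    exponential [c] is the Hellinger affinity. *)
Lemma two_point_affinity (u v : nat -> R) :
  error_le psi u -> error_le (negb \o psi) v ->
  expR (- dot N (u \- v) (u \- v) / 8) <= 7 / 8.
Proof.
move=> [r r4 ur] [s s4 vs].
pose h i := (u i + v i) / 2; pose c := expR (- dot N (u \- v) (u \- v) / 8).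
have L := gauss_meanZ (ler0n _ 2) (gauss_meanZ (expR_ge0 _ : 0 <= c) (gauss_mean_lik N h)).
(* With these weights the majorant is [2 * lik u + lik v / 2] where [psi] rejects and
   [lik u / 2 + 2 * lik v] elsewhere; its mean is at most 7/4. *)
have a0 : 0 <= 3 / 2 :> R by lra.
have b0 : 0 <= 1 / 2 :> R by lra.
have U := gauss_meanD
  (gauss_meanZ a0 (gauss_meanD ur vs))
  (gauss_meanZ b0 (gauss_meanD (gauss_mean_lik N u) (gauss_mean_lik N v))).
have := gauss_mean_le L U; rewrite -/c => H.
suff : 2 * (c * 1) <= 3 / 2 * (r + s) + 1 / 2 * (1 + 1) by lra.
apply: H => t /=.
have uv : (c * lik h t) ^+ 2 = lik u t * lik v t.
  rewrite exprMn [lik h t ^+ 2]expr2 !likM /c expr2 mulrA.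
  have -> : h \+ h = u \+ v by apply/funext => i; rewrite /h /=; field.
  congr (_ * _); rewrite -!expRD; congr expR.
  rewrite /dot !mulNr !mulr_suml -!sumrN -!big_split/=; apply: eq_bigr => i _.
  by rewrite /h; field.
have u0 := lik_gt0 u t; have v0 := lik_gt0 v t.
have := @ler_sqr_mul R (c * lik h t) _ _ (ltW u0) (ltW v0).
have := @ler_sqr_mul R (c * lik h t) _ _ (ltW v0) (ltW u0).
rewrite uv mulrC lexx => /(_ isT) H1 /(_ isT) H2.
by case: (psi t); rewrite /=; lra.
Qed.

End two_point.

(** * Testing between two mixtures that factor over blocks *)

Section block_mixture.
Context {R : realType} (N k : nat) (T : finType) (psi : N.-tuple R -> bool).
Variables (mu : bool -> 'I_k -> T -> nat -> R) (C K : R).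
Hypothesis T0 : (0 < #|T|)%N.
Hypothesis orth : forall e e' j l a b, j != l ->
  dot N (mu e j a) (mu e' l b) = 0.

Let q e j (t : N.-tuple R) := avg (fun a => lik (mu e j a) t).

Hypothesis C0 : 0 <= C.
Hypothesis q_low : forall e j t, 1 <= C * q e j t.

(** The integral of [q e j * q e' j]; thus [mK] bounds by [K] the integral of
    [(q false j - q true j) ^+ 2]. *)
Let m e e' j := avg (fun a => avg (fun b => expR (dot N (mu e j a) (mu e' j b)))).

Hypothesis mK : forall j,
  m false false j + m true true j - 2 * m false true j <= K.

(** Pairing the hypothesis with the choice makes the averaged block density itself a uniform
    mixture, over [bool * T]. *)
Let u (j : 'I_k) (x : bool * T) := mu x.1 j x.2.

Let qbarE j t : (q false j t + q true j t) / 2 = avg (fun x => lik (u j x) t).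
Proof. by rewrite avg_pair avg_bool. Qed.

Let u_orth (w : 'I_k -> bool * T) j l : j != l ->
  dot N (u j (w j)) (u l (w l)) = 0.
Proof. exact: orth. Qed.

Let BT0 : (0 < #|{: bool * T}|)%N.
Proof. by rewrite card_prod card_bool muln_gt0. Qed.

Let FBT0 : (0 < #|{ffun 'I_k -> bool * T}|)%N.
Proof. by rewrite card_ffun expn_gt0 BT0. Qed.

Let FT0 : (0 < #|{ffun 'I_k -> T}|)%N.
Proof. by rewrite card_ffun expn_gt0 T0. Qed.

Let mean_qbar :
  gauss_mean (fun t => \prod_j ((q false j t + q true j t) / 2)) 1.
Proof.
apply: eq_gauss_mean (@gauss_mean_avg R N {ffun 'I_k -> bool * T}
  (fun w => lik (fun i => \sum_j u j (w j) i)) (fun=> 1)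
  (fun w => gauss_mean_lik N _)).
  move=> t; rewrite (eq_bigr _ (fun j _ => qbarE j t)) avg_prod.
  by apply: eq_avg => w; rewrite lik_sum// => j l; exact: u_orth.
exact: avg_cst.
Qed.

Let P j t := \prod_(l | l != j) ((q false l t + q true l t) / 2).

(** Block [j] is given mean 0, whose likelihood is 1, so that the product omitting [j] becomes a
    full product to which [lik_sum] applies. *)
Let u' j l x : nat -> R := if l == j then fun=> 0 else u l x.

Let dot0l (v : nat -> R) : dot N (fun=> 0) v = 0.
Proof. by rewrite /dot big1// => i _; rewrite mul0r. Qed.

Let lik0 (t : N.-tuple R) : lik (fun=> 0) t = 1.
Proof.
rewrite /lik dot0l big1 ?mul0r ?subr0 ?expR0// => i _.
by rewrite mul0r.
Qed.

Let PE j t : P j t = avg (fun w : {ffun 'I_k -> bool * T} =>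
  lik (fun i => \sum_l u' j l (w l) i) t).
Proof.
have -> : P j t = \prod_l avg (fun x => lik (u' j l x) t).
  rewrite [RHS](bigD1 j)//= [X in X * _](_ : _ = 1); last first.
    rewrite -[RHS](avg_cst 1 BT0); apply: eq_avg => x.
    by rewrite /u' eqxx lik0.
  rewrite mul1r; apply: eq_bigr => l lj; rewrite qbarE.
  by apply: eq_avg => x; rewrite /u' (negbTE lj).
rewrite avg_prod; apply: eq_avg => w; rewrite lik_sum// => i l il.
rewrite /u'; case: ifP => _; first exact: dot0l.
case: ifP => _; first by rewrite dotC dot0l.
exact: u_orth.
Qed.

Let mean_Pqq e e' j :
  gauss_mean (fun t => P j t * (q e j t * q e' j t)) (m e e' j).
Proof.
apply: eq_gauss_mean (@gauss_mean_avg R N {ffun 'I_k -> bool * T}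
  (fun w t => avg (fun a => avg (fun b =>
     lik (fun i => \sum_l u' j l (w l) i) t *
     (lik (mu e j a) t * lik (mu e' j b) t)))) (fun=> m e e' j) _).
- move=> t; rewrite PE -avgZr; apply: eq_avg => w.
  rewrite /q avgM -avgZl; apply: eq_avg => a.
  by rewrite -avgZl.
- exact: avg_cst.
- move=> w; apply: gauss_mean_avg => a; apply: gauss_mean_avg => b.
  by apply: gauss_mean_lik3; rewrite dot_suml big1// => l _; rewrite /u';
    case: ifP => [_|/negbT lj]; rewrite ?dot0l// orth.
Qed.

Let mean_Q e : gauss_mean (fun t => \prod_j q e j t) 1.
Proof.
apply: eq_gauss_mean (@gauss_mean_avg R N {ffun 'I_k -> T}
  (fun w => lik (fun i => \sum_j mu e j (w j) i)) (fun=> 1)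
  (fun w => gauss_mean_lik N _)).
  move=> t; rewrite avg_prod.
  by apply: eq_avg => w; rewrite lik_sum// => j l; exact: orth.
exact: avg_cst.
Qed.

Let mean_err e (b : N.-tuple R -> bool) :
  (forall w : {ffun 'I_k -> T}, error_le b (fun i => \sum_j mu e j (w j) i)) ->
  exists2 r, r <= 1 / 4 & gauss_mean (fun t => (b t)%:R * \prod_j q e j t) r.
Proof.
move=> H.
have /choice[r Hr] (w : {ffun 'I_k -> T}) : exists r, r <= 1 / 4 /\
    gauss_mean (fun t => (b t)%:R * lik (fun i => \sum_j mu e j (w j) i) t) r.
  by have [r] := H w; exists r.
exists (avg r).
  by rewrite -[leRHS](avg_cst _ FT0); apply: le_avg => w; have [] := Hr w.
apply: eq_gauss_mean (gauss_mean_avg (fun w => (Hr w).2)) => // t.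
rewrite avgZl avg_prod; congr (_ * _).
by apply: eq_avg => w; rewrite lik_sum// => j l; exact: orth.
Qed.

(** Integrating [prod_hellinger] over the rejection region, and its mirror image over the
    complement, yields 2 <= 7/4 + k C K / 2. *)
Lemma block_mixture_bound :
  (forall w : {ffun 'I_k -> T},
     error_le psi (fun i => \sum_j mu false j (w j) i)) ->
  (forall w : {ffun 'I_k -> T},
     error_le (negb \o psi) (fun i => \sum_j mu true j (w j) i)) ->
  1 <= 2 * k%:R * C * K.
Proof.
move=> /mean_err[r r4 Er] /mean_err[s s4 Es].
have C2 : 0 <= C / 2 by rewrite divr_ge0.
have a0 : 0 <= 3 / 2 :> R by lra.
have b0 : 0 <= 1 / 2 :> R by lra.
(* The cross terms of the squares stand on the smaller side, since [gauss_mean] admits only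
   nonnegative functions. *)
have L := gauss_meanD (gauss_meanZ (ler0n _ 2) mean_qbar)
  (@gauss_mean_sum _ _ _ (index_enum 'I_k) xpredT _ _
     (fun j _ => gauss_meanZ C0 (mean_Pqq false true j))).
have U := gauss_meanD
  (@gauss_mean_sum _ _ _ (index_enum 'I_k) xpredT _ _
     (fun j _ => gauss_meanZ C2 (gauss_meanD (mean_Pqq false false j)
                                             (mean_Pqq true true j))))
  (gauss_meanD (gauss_meanZ a0 (gauss_meanD Er Es))
     (gauss_meanZ b0 (gauss_meanD (mean_Q false) (mean_Q true)))).
have qp e j t : 0 < q e j t by apply: avg_gt0 => // a; exact: lik_gt0.
have qC j t : 1 <= C * ((q false j t + q true j t) / 2).
  by have := q_low false j t; have := q_low true j t; lra.
have := gauss_mean_le L U => /=.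
set sm01 := \sum_(j <- _) _; set sm := \sum_(j <- _) _ => H.
have smK : sm - sm01 <= k%:R * (C / 2 * K).
  rewrite /sm /sm01 -sumrB.
  apply: (@le_trans _ _ (\sum_(j : 'I_k) C / 2 * K)); last first.
    by rewrite sumr_const card_ord mulr_natl.
  apply: ler_sum => j _; have := mK j; nra.
suff : 2 * 1 + sm01 <= sm + (3 / 2 * (r + s) + 1 / 2 * (1 + 1)) by lra.
apply: H => t.
have key : \sum_j (C / 2 * (P j t * (q false j t - q true j t) ^+ 2)) =
    \sum_j C / 2 * (P j t * (q false j t * q false j t)
                    + P j t * (q true j t * q true j t))
    - \sum_j C * (P j t * (q false j t * q true j t)).
  by rewrite -sumrB; apply: eq_bigr => j _; field.
have H0 := prod_hellinger (fun j => qp false j t) (fun j => qp true j t) (fun j => qC j t).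
(* The mirror image, with the two hypotheses exchanged, serves where [psi] accepts. *)
have H1 : 2 * \prod_j ((q false j t + q true j t) / 2) <=
  \sum_j (C / 2 * (P j t * (q false j t - q true j t) ^+ 2))
  + (2 * \prod_j q true j t + (\prod_j q false j t) / 2).
  have qC' j : 1 <= C * ((q true j t + q false j t) / 2).
    by rewrite addrC; exact: qC.
  have := prod_hellinger (fun j => qp true j t) (fun j => qp false j t) qC'.
  rewrite (eq_bigr (fun j => (q false j t + q true j t) / 2)); last first.
    by move=> j _; rewrite addrC.
  move=> /le_trans; apply; rewrite lerD2r le_eqVlt; apply/orP; left; apply/eqP.
  apply: eq_bigr => j _; congr (_ * (_ * _)); last by ring.
  by apply: eq_bigr => l _; rewrite addrC.
rewrite -/(P _ _) in H0 H1.
rewrite key in H1.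
have {}H0 : 2 * \prod_j ((q false j t + q true j t) / 2) <=
  \sum_j (C / 2 * (P j t * (q false j t - q true j t) ^+ 2))
  + (2 * \prod_j q false j t + (\prod_j q true j t) / 2) by exact: H0.
rewrite key in H0.
by case: (psi t) => /=; lra.
Qed.

End block_mixture.

(** * The flattened mean vector of the data *)

Section lfht_mean_theory.
Context {R : realType} (D n m : nat).
Implicit Types th : 'I_D -> R.

(** Labels of the flat positions: [Some false], [Some true] and [None] stand for the samples X, Y
    and Z. *)
Definition sample_index : seq (option bool * 'I_D) :=
  flatten (nseq n [seq (Some false, k) | k <- enum 'I_D]
        ++ nseq n [seq (Some true, k) | k <- enum 'I_D]
        ++ nseq m [seq (None, k) | k <- enum 'I_D]).

Definition mean_at th1 th2 th (x : option bool * 'I_D) : R :=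
  match x.1 with
  | Some false => th1 x.2 | Some true => th2 x.2 | None => th x.2
  end.

Lemma lfht_meanE th1 th2 th i : lfht_mean n m th1 th2 th i =
  nth 0 [seq mean_at th1 th2 th x | x <- sample_index] i.
Proof.
rewrite /lfht_mean /sample_index map_flatten !map_cat !map_nseq /coords.
by move: (enum _) => e; rewrite -!map_comp.
Qed.

Lemma size_sample_index : size sample_index = ((n + n + m) * D)%N.
Proof.
rewrite /sample_index; move: (size_enum_ord D); move: (enum _) => e eD.
rewrite size_flatten /shape !map_cat !map_nseq !size_map eD.
by rewrite !sumn_cat !sumn_nseq -!mulnDr mulnC addnA.
Qed.

Lemma big_sample_index (F : option bool * 'I_D -> R) :
  \sum_(x <- sample_index) F x =
  n%:R * (\sum_k F (Some false, k)) + n%:R * (\sum_k F (Some true, k))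
  + m%:R * (\sum_k F (None, k)).
Proof.
rewrite /sample_index big_flatten !big_cat/= !big_nseq !iter_addr !addr0.
have E (w : option bool) :
    \sum_(x <- [seq (w, k) | k <- enum 'I_D]) F x = \sum_k F (w, k).
  by rewrite big_map big_enum.
by rewrite !E !mulr_natl addrA.
Qed.

Lemma dot_lfht_mean (a b c a' b' c' : 'I_D -> R) :
  dot ((n + n + m) * D) (lfht_mean n m a b c) (lfht_mean n m a' b' c') =
  n%:R * (\sum_k a k * a' k) + n%:R * (\sum_k b k * b' k)
  + m%:R * (\sum_k c k * c' k).
Proof.
rewrite -(big_sample_index (fun x => mean_at a b c x * mean_at a' b' c' x)).
(* [big_nth] needs a default element, which an empty list does not supply. *)
case E: sample_index => [|x0 L].
  rewrite /dot -size_sample_index E big_nil big1// => i _.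
  by rewrite lfht_meanE E/= nth_nil mul0r.
rewrite -E (big_nth x0) big_mkord /dot -size_sample_index.
by apply: eq_bigr => i _; rewrite !lfht_meanE !(nth_map x0).
Qed.

Lemma lfht_mean_sum (I : finType) (a b c : I -> 'I_D -> R) i :
  \sum_j lfht_mean n m (a j) (b j) (c j) i =
  lfht_mean n m (fun k => \sum_j a j k) (fun k => \sum_j b j k)
    (fun k => \sum_j c j k) i.
Proof.
(* Beyond the data both sides take the default value 0. *)
rewrite lfht_meanE; have [iN|iN] := ltnP i (size sample_index).
  case E: sample_index iN => [//|x0 L]; rewrite -E => iN.
  rewrite (nth_map x0)//; under eq_bigr do rewrite lfht_meanE (nth_map x0)//.
  by rewrite /mean_at; case: (_.1) => [[]|].
rewrite nth_default ?size_map// big1// => j _.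
by rewrite lfht_meanE nth_default ?size_map.
Qed.

Lemma lfht_meanN (a b c : 'I_D -> R) i :
  lfht_mean n m (fun k => - a k) (fun k => - b k) (fun k => - c k) i =
  - lfht_mean n m a b c i.
Proof.
rewrite !lfht_meanE; have [iN|iN] := ltnP i (size sample_index).
  case E: sample_index iN => [//|x0 L]; rewrite -E => iN.
  by rewrite !(nth_map x0)// /mean_at; case: (_.1) => [[]|].
by rewrite !nth_default ?size_map// oppr0.
Qed.

End lfht_mean_theory.

(** * Sparse vectors with one signed entry per block *)

Section sparse_prior.
Context {R : realType} (D k s : nat) (b : R).
Hypothesis ksD : (k * s <= D)%N.

(** Block [j] consists of the [s] consecutive coordinates from [j * s]; [x] holds the position
    inside the block and the sign. *)
Definition atom (j : 'I_k) (x : 'I_s * bool) (t : 'I_D) : R :=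
  if nat_of_ord t == (j * s + x.1)%N then (-1) ^+ x.2 * b else 0.

Definition spike (w : 'I_k -> 'I_s * bool) (t : 'I_D) : R :=
  \sum_j atom j (w j) t.

Lemma block_index_inj (j l : 'I_k) (i i' : 'I_s) :
  (j * s + i == l * s + i')%N = (j == l) && (i == i').
Proof.
have s0 : (0 < s)%N by case: s i => [[]|].
apply/eqP/andP => [E|[/eqP-> /eqP->]//].
have := congr1 (divn^~ s) E; rewrite !divnMDl// !divn_small// !addn0 => jl.
split; first by rewrite -val_eqE/= jl.
by move: E; rewrite jl => /addnI ii'; rewrite -val_eqE/= ii'.
Qed.

Lemma block_index_lt (j : 'I_k) (i : 'I_s) : (j * s + i < D)%N.
Proof.
apply: leq_trans ksD; apply: (@leq_trans (j * s + s)%N); first by rewrite ltn_add2l.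
by rewrite addnC -mulSn leq_mul2r ltn_ord orbT.
Qed.

Lemma sum_atom (j l : 'I_k) (x y : 'I_s * bool) :
  \sum_t atom j x t * atom l y t =
  if (j == l) && (x.1 == y.1) then (-1) ^+ (x.2 (+) y.2) * b ^+ 2 else 0.
Proof.
rewrite (bigD1 (Ordinal (block_index_lt j x.1)))//= big1 ?addr0; last first.
  move=> t; rewrite -val_eqE/= => /negbTE tE.
  by rewrite /atom tE mul0r.
rewrite /atom/= eqxx block_index_inj; case: ifP => _; last by rewrite mulr0.
by rewrite signr_addb; ring.
Qed.

Lemma sum_spike2 w : \sum_t spike w t ^+ 2 = k%:R * b ^+ 2.
Proof.
transitivity (\sum_t \sum_j \sum_l atom j (w j) t * atom l (w l) t).
  apply: eq_bigr => t _; rewrite expr2 /spike mulr_suml.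
  by apply: eq_bigr => j _; rewrite mulr_sumr.
rewrite exchange_big/=.
transitivity (\sum_(j < k) b ^+ 2); last by rewrite sumr_const card_ord mulr_natl.
apply: eq_bigr => j _; rewrite exchange_big/= (bigD1 j)//= sum_atom !eqxx/=.
rewrite addbb expr0 mul1r big1 ?addr0// => l lj.
by rewrite sum_atom eq_sym (negbTE lj).
Qed.

Lemma sum_powR_spike (p A : R) (a : 'I_D -> R) (d : nat) w : 0 <= b -> 0 < p -> 0 < A ->
  (k * s <= d)%N ->
  (forall t : 'I_D, 0 < a t) ->
  (forall t : 'I_D, (t < d)%N -> A <= a t `^ p) ->
  \sum_t (`|spike w t| `^ p / a t `^ p) <= k%:R * (b `^ p / A).
Proof.
move=> b0 p0 A0 ksd a0 aA.
have bA0 : 0 <= b `^ p / A by rewrite divr_ge0 ?powR_ge0 ?ltW.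
pose idx (j : 'I_k) := (j * s + (w j).1)%N.
(* By [block_index_inj] at most one block has its entry at [t]; exchanging the sums then counts each
   block once. *)
apply: (@le_trans _ _ (\sum_(t < D) \sum_(j < k)
    (if nat_of_ord t == idx j then b `^ p / A else 0))).
  apply: ler_sum => t _.
  case: (pickP (fun j : 'I_k => nat_of_ord t == idx j)) => [j /eqP tj|no].
    have tl l : l != j -> (nat_of_ord t == idx l) = false.
      by move=> lj; rewrite tj /idx block_index_inj eq_sym (negbTE lj).
    rewrite (bigD1 j)//= tj eqxx big1 ?addr0; last first.
      by move=> l lj; rewrite -tj tl.
    have -> : spike w t = (-1) ^+ (w j).2 * b.
      rewrite /spike (bigD1 j)//= big1 ?addr0; last first.
        by move=> l lj; rewrite /atom -/(idx l) tl.
      by rewrite /atom -/(idx j) tj eqxx.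
    rewrite normrMsign ger0_norm// ler_wpM2l ?powR_ge0// lef_pV2 ?posrE ?powR_gt0//.
    apply: aA; apply: leq_trans ksd; rewrite tj.
    apply: (@leq_trans (j * s + s)%N); first by rewrite ltn_add2l.
    by rewrite addnC -mulSn leq_mul2r ltn_ord orbT.
  have -> : spike w t = 0.
    by rewrite /spike big1// => j _; rewrite /atom -/(idx j) no.
  rewrite normr0 powR0 ?gt_eqF// mul0r; apply: sumr_ge0 => j _.
  by case: ifP.
rewrite exchange_big/=.
apply: (@le_trans _ _ (\sum_(j < k) (b `^ p / A))); last first.
  by rewrite sumr_const card_ord mulr_natl.
apply: ler_sum => j _; rewrite (bigD1 (Ordinal (block_index_lt j (w j).1)))//=.
rewrite eqxx big1 ?addr0// => t; rewrite -val_eqE/= => /negbTE tE.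
by rewrite /idx tE.
Qed.

End sparse_prior.

(** * The mixture bound for sparse priors *)

Section sparse_bound.
Context {R : realType}.

Definition hcos (x : R) : R := (expR x + expR (- x)) / 2.

Lemma hcos_ge1 (x : R) : 1 <= hcos x.
Proof.
rewrite /hcos expRN; have e0 := expR_gt0 x.
rewrite -(ler_pM2r e0) (_ : _ / 2 * _ = (expR x ^+ 2 + 1) / 2); last first.
  by field; rewrite gt_eqF.
have : 0 <= (expR x - 1) ^+ 2 by exact: sqr_ge0.
nra.
Qed.

(** Averaging over the sign turns the factor depending on [t] into a hyperbolic cosine, which is at
    least 1. *)
Lemma lik_opp_avg N (u v : nat -> R) (t : N.-tuple R) : (forall i, v i = - u i) ->
  expR (- dot N u u / 2) <= (lik u t + lik v t) / 2.
Proof.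
move=> vE; rewrite /lik.
have -> : dot N v v = dot N u u by apply: eq_bigr => i _; rewrite vE mulrNN.
have -> : \sum_(i < N) v i * tnth t i = - \sum_(i < N) u i * tnth t i.
  by rewrite -sumrN; apply: eq_bigr => i _; rewrite vE mulNr.
set y := \sum_(i < N) _; rewrite !expRD -mulrDl mulNr mulrAC.
by rewrite -[leLHS]mul1r ler_wpM2r ?expR_ge0//; exact: (hcos_ge1 y).
Qed.

Variables (D n m k s : nat) (b : R) (al be ga : bool -> R).
Variable psi : ((n + n + m) * D).-tuple R -> bool.
Hypothesis ksD : (k * s <= D)%N.
Hypothesis s0 : (0 < s)%N.

Let N := ((n + n + m) * D)%N.
(** Under hypothesis [e] the three means are the multiples [al e], [be e], [ga e] of one sparse
    vector; [c e e'] is the factor this puts on inner products. *)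
Let c e e' := n%:R * (al e * al e') + n%:R * (be e * be e') + m%:R * (ga e * ga e').
Let mu e (j : 'I_k) (x : 'I_s * bool) := lfht_mean n m
  (fun t : 'I_D => al e * atom b j x t) (fun t => be e * atom b j x t)
  (fun t => ga e * atom b j x t).

Let dot_mu e e' j l x y : dot N (mu e j x) (mu e' l y) =
  c e e' * \sum_(t < D) atom b j x t * atom b l y t.
Proof.
rewrite /mu dot_lfht_mean /c !mulrDl -!mulrA.
by congr (_ * _ + _ * _ + _ * _); rewrite !mulrA mulr_sumr;
  apply: eq_bigr => t _; ring.
Qed.

(** The positions coincide with probability 1/s, and the random sign then produces [hcos]; otherwise
    the exponent is 0. *)
Let avg_expR (z : R) (x : 'I_s * bool) : avg (fun y : 'I_s * bool =>
    expR (z * if x.1 == y.1 then (-1) ^+ (x.2 (+) y.2) * b ^+ 2 else 0)) =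
  1 + (hcos (z * b ^+ 2) - 1) / s%:R.
Proof.
rewrite avg_pair.
transitivity (avg (fun i : 'I_s => if x.1 == i then hcos (z * b ^+ 2) else 1)).
  apply: eq_avg => i /=; rewrite avg_bool; case: ifP => _.
    rewrite /hcos; case: x.2; rewrite /= expr0 expr1 !mul1r mulN1r mulrN//.
    by rewrite addrC.
  by rewrite mulr0 expR0; field.
rewrite /avg card_ord (bigD1 x.1)//= eqxx.
rewrite (eq_bigr (fun=> 1)); last by move=> i ix; rewrite eq_sym (negbTE ix).
rewrite sumr_const cardC1 card_ord -subn1 natrB//; field.
by rewrite pnatr_eq0 -lt0n.
Qed.

(** [block_mixture_bound] with [C = expR (z * b ^+ 2 / 2)] from [lik_opp_avg] and [K] from
    [avg_expR], where only the difference of the [hcos] terms survives. *)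
Lemma sparse_bound (z z' : R) :
  c false false = z -> c true true = z -> c false true = z' ->
  (forall w : 'I_k -> 'I_s * bool, error_le psi (lfht_mean n m
     (fun t : 'I_D => al false * spike b w t) (fun t => be false * spike b w t)
     (fun t => ga false * spike b w t))) ->
  (forall w : 'I_k -> 'I_s * bool, error_le (negb \o psi) (lfht_mean n m
     (fun t : 'I_D => al true * spike b w t) (fun t => be true * spike b w t)
     (fun t => ga true * spike b w t))) ->
  s%:R <= 4 * k%:R * expR (z * b ^+ 2 / 2) * (hcos (z * b ^+ 2) - hcos (z' * b ^+ 2)).
Proof.
move=> z00 z11 z01 E0 E1.
have zz e : c e e = z by case: e.
have sp : 0 < s%:R :> R by rewrite ltr0n.
have S0 : (0 < #|{: 'I_s * bool}|)%N.
  by rewrite card_prod card_bool card_ord muln_gt0 s0.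
have orth e e' j l x y : j != l -> dot N (mu e j x) (mu e' l y) = 0.
  by move=> jl; rewrite dot_mu sum_atom// (negbTE jl) mulr0.
have mE e e' j : avg (fun x => avg (fun y => expR (dot N (mu e j x) (mu e' j y)))) =
    1 + (hcos (c e e' * b ^+ 2) - 1) / s%:R.
  rewrite -[RHS](avg_cst _ S0); apply: eq_avg => x; rewrite -(avg_expR _ x).
  by apply: eq_avg => y; rewrite dot_mu sum_atom// eqxx.
have low e j (t : N.-tuple R) : 1 <= expR (z * b ^+ 2 / 2) * avg (fun x => lik (mu e j x) t).
  have : expR (- (z * b ^+ 2) / 2) <= avg (fun x => lik (mu e j x) t).
    rewrite avg_pair -[leLHS](@avg_cst _ 'I_s); last by rewrite card_ord.
    apply: le_avg => i; rewrite avg_bool.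
    have <- : dot N (mu e j (i, false)) (mu e j (i, false)) = z * b ^+ 2.
      by rewrite dot_mu sum_atom// !eqxx/= expr0 mul1r zz.
    apply: (@lik_opp_avg N (mu e j (i, false)) (mu e j (i, true)) t) => r.
    have aN (x : R) : (fun t0 : 'I_D => x * atom b j (i, true) t0) =
        (fun t0 : 'I_D => - (x * atom b j (i, false) t0)).
      apply/funext => t0; rewrite /atom/= expr0 expr1 -mulrN.
      by case: ifP; rewrite ?oppr0 ?mul1r ?mulN1r.
    by rewrite /mu !aN lfht_meanN.
  have e1 : 1 = expR (z * b ^+ 2 / 2) * expR (- (z * b ^+ 2) / 2).
    by rewrite -expRD mulNr subrr expR0.
  by move=> h; rewrite [leLHS]e1 ler_pM2l ?expR_gt0.
have H := @block_mixture_bound R N k _ psi mu (expR (z * b ^+ 2 / 2))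
  (2 / s%:R * (hcos (z * b ^+ 2) - hcos (z' * b ^+ 2))) S0 orth (expR_ge0 _) low.
have {H} : 1 <= 2 * k%:R * expR (z * b ^+ 2 / 2) *
    (2 / s%:R * (hcos (z * b ^+ 2) - hcos (z' * b ^+ 2))).
  apply: H.
  - by move=> j; rewrite !mE !zz z01 le_eqVlt; apply/orP; left; apply/eqP; field; rewrite gt_eqF.
  - move=> w; move: (E0 w).
    rewrite (_ : (fun i => \sum_j mu false j (w j) i) = lfht_mean n m
      (fun t : 'I_D => al false * spike b w t) (fun t => be false * spike b w t)
      (fun t => ga false * spike b w t))//.
    by apply/funext => i; rewrite /mu lfht_mean_sum; congr (lfht_mean _ _ _ _ _ i);
      apply/funext => t; rewrite /spike mulr_sumr.
  - move=> w; move: (E1 w).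
    rewrite (_ : (fun i => \sum_j mu true j (w j) i) = lfht_mean n m
      (fun t : 'I_D => al true * spike b w t) (fun t => be true * spike b w t)
      (fun t => ga true * spike b w t))//.
    by apply/funext => i; rewrite /mu lfht_mean_sum; congr (lfht_mean _ _ _ _ _ i);
      apply/funext => t; rewrite /spike mulr_sumr.
rewrite -(ler_pM2l sp) mulr1 => /le_trans; apply.
by rewrite le_eqVlt; apply/orP; left; apply/eqP; field; rewrite gt_eqF.
Qed.

End sparse_bound.

(** * Numerical estimates for exponentials *)

Section exp_estimates.
Context {R : realType}.
Implicit Types x y : R.

Lemma expR_le_inv x : x < 1 -> expR x <= (1 - x)^-1.
Proof.
move=> x1; rewrite -[expR x]invrK -expRN lef_pV2 ?posrE ?expR_gt0 ?subr_gt0//.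
exact: expR_ge1Dx.
Qed.

Lemma expR_sub1_le x : expR x - 1 <= x * expR x.
Proof.
have := expR_ge1Dx (- x); rewrite -(ler_pM2r (expR_gt0 x)) -expRD addNr expR0.
lra.
Qed.

Lemma hcos_sub1_le y : 0 <= y -> y <= 3 / 8 ->
  expR (y / 2) * (hcos y - 1) <= 97 / 100 * y ^+ 2.
Proof.
(* In terms of [f] the left side is [(f ^+ 4 - 1) ^+ 2 / (2 * f ^+ 2)], at most
   [y ^+ 2 * f ^+ 6 / 2]; here [f ^+ 3 <= 32 / 23], and half the square of 32/23 is below 97/100. *)
move=> y0 y1; set f := expR (y / 4); have f0 : 0 < f := expR_gt0 _.
have e4 : expR y = f ^+ 4.
  by rewrite -expRM_natr; congr expR; field.
have e2 : expR (y / 2) = f ^+ 2.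
  by rewrite -expRM_natr; congr expR; field.
have f3 : f ^+ 3 <= (1 - 3 / 4 * y)^-1.
  rewrite -expRM_natr; have -> : y / 4 * 3%:R = 3 / 4 * y by field.
  by apply: expR_le_inv; lra.
have fb : f ^+ 3 <= 32 / 23.
  apply: le_trans f3 _; rewrite -[leRHS]invrK lef_pV2 ?posrE; lra.
have f4 := expR_sub1_le y; have g4 := expR_ge1Dx y; rewrite e4 in f4 g4.
rewrite /hcos expRN e4 e2.
have -> : f ^+ 2 * ((f ^+ 4 + (f ^+ 4)^-1) / 2 - 1) =
    (f ^+ 4 - 1) ^+ 2 / (2 * f ^+ 2) by field; rewrite gt_eqF.
rewrite ler_pdivrMr ?mulr_gt0 ?exprn_gt0//.
apply: (@le_trans _ _ ((y * f ^+ 4) ^+ 2)).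
  rewrite ler_pXn2r// ?nnegrE; first lra.
  by rewrite mulr_ge0// exprn_ge0// ltW.
have -> : (y * f ^+ 4) ^+ 2 = y ^+ 2 * f ^+ 2 * (f ^+ 3) ^+ 2 by ring.
rewrite [leRHS](_ : _ = y ^+ 2 * f ^+ 2 * (194 / 100)); last by field.
rewrite ler_wpM2l//; first by apply: mulr_ge0; exact: sqr_ge0.
have : 0 <= f ^+ 3 by rewrite exprn_ge0 ?ltW.
move: fb; clear; move: (f ^+ 3) => g g1 g0; nra.
Qed.

Lemma hsin_le y : 0 <= y -> y <= 1 / 2 -> expR y - expR (- y) <= 4 * y.
Proof.
move=> y0 y1; have e2 := @expR_le_inv y ltac:(lra).
have e3 : expR y <= 2.
  by apply: le_trans e2 _; rewrite -[leRHS]invrK lef_pV2 ?posrE; lra.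
have := expR_sub1_le y; have := expR_ge1Dx (- y); nra.
Qed.

(** The difference equals 2 sinh x sinh y, and [hsin_le] bounds each factor. *)
Lemma hcos_addB_le x y : 0 <= x -> x <= 1 / 2 -> 0 <= y -> y <= 1 / 2 ->
  hcos (x + y) - hcos (x - y) <= 8 * (x * y).
Proof.
move=> x0 x1 y0 y1.
have -> : hcos (x + y) - hcos (x - y) =
    (expR x - expR (- x)) * (expR y - expR (- y)) / 2.
  by rewrite /hcos !opprD opprK !expRD; field.
have := hsin_le x0 x1; have := hsin_le y0 y1.
have mono (z : R) : 0 <= z -> 0 <= expR z - expR (- z).
  by move=> z0; rewrite subr_ge0 ler_expR; lra.
have := mono _ x0; have := mono _ y0.
move: (expR x - _) (expR y - _) => X Y Y0 X0 Yy Xx.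
have : X * Y <= (4 * x) * (4 * y) by apply: ler_pM.
lra.
Qed.

End exp_estimates.

(** * The parameter set and its critical dimension *)

Section ellipsoid.
Context {R : realType} (D n : nat) (p eps : R) (a : 'I_D -> R).
Hypothesis p1 : 1 <= p.
Hypothesis p2 : p <= 2.
Hypothesis a_noninc : forall s t : 'I_D, (s <= t)%N -> a t <= a s.
Hypothesis a_gt0 : forall t, 0 < a t.
Hypothesis eps_gt0 : 0 < eps.
Hypothesis n_gt0 : (0 < n)%N.

Let p_ge0 : 0 <= p. Proof. exact: le_trans ler01 p1. Qed.

Lemma Gamma_setZ (c : R) (th : 'I_D -> R) : `|c| <= 1 ->
  Gamma_set p a th -> Gamma_set p a (fun t => c * th t).
Proof.
move=> c1; apply: le_trans; apply: ler_sum => t _.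
rewrite ler_wpM2r ?invr_ge0 ?powR_ge0// ge0_ler_powR ?nnegrE ?normr_ge0//.
by rewrite normrM ler_piMl.
Qed.

Lemma d_l_le : (d_l p a n eps <= D)%N.
Proof. by apply/bigmax_leqP => t _. Qed.

(** A nonzero maximum is attained at some [t0], and monotonicity of [a] carries the inequality down
    to [t <= t0]. *)
Lemma d_l_bound (t : 'I_D) : (t < d_l p a n eps)%N ->
  192 * eps ^+ 2 * n%:R `^ ((2 - p) / 2) <= a t `^ p.
Proof.
have [d0|[t0 [Pt0 d0]]] : d_l p a n eps = 0%N \/ exists t0 : 'I_D,
    192 * eps ^+ 2 <= a t0 `^ p * n%:R `^ ((p - 2) / 2) /\ d_l p a n eps = t0.+1.
- apply: (big_ind (fun x => x = 0%N \/ exists t0 : 'I_D,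
    192 * eps ^+ 2 <= a t0 `^ p * n%:R `^ ((p - 2) / 2) /\ x = t0.+1)).
  + by left.
  + by move=> x y Hx Hy; case: (leqP x y).
  + by move=> i Pi; right; exists i.
- by rewrite d0.
rewrite d0 ltnS => tt0.
have np : 0 < n%:R `^ ((2 - p) / 2) :> R by apply: powR_gt0; rewrite ltr0n.
apply: (@le_trans _ _ (a t0 `^ p)); last first.
  by apply: (ge0_ler_powR p_ge0); rewrite ?nnegrE; [exact: ltW|exact: ltW|exact: a_noninc].
move: Pt0; have -> : (p - 2) / 2 = - ((2 - p) / 2) by field.
by rewrite powRN ler_pdivlMr.
Qed.

(** With u = (2 - p) / 2, the energy bound gives k b^p <= eps^2 (k / eps^2)^u <= eps^2 (192^2 n)^u.
    As p >= 1 means u <= 1/2, this is at most 192 eps^2 n^u, the lower bound on a_t^p from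
    [d_l_bound]. *)
Lemma Gamma_spike (k s : nat) (b : R) (w : 'I_k -> 'I_s * bool) :
  (0 < k)%N -> (k * s <= d_l p a n eps)%N ->
  k%:R <= 192 ^+ 2 * (n%:R * eps ^+ 2) -> 0 <= b -> k%:R * b ^+ 2 <= eps ^+ 2 ->
  Gamma_set p a (spike b w).
Proof.
move=> k0 ksd kx b0 kb.
have ksD := leq_trans ksd d_l_le.
have kp : 0 < k%:R :> R by rewrite ltr0n.
have e2 : 0 < eps ^+ 2 by rewrite exprn_gt0.
pose u := (2 - p) / 2; pose A := 192 * eps ^+ 2 * n%:R `^ u.
have A0 : 0 < A by rewrite !mulr_gt0//; apply: powR_gt0; rewrite ltr0n.
rewrite /Gamma_set/=.
apply: le_trans (@sum_powR_spike R D k s b ksD p A a _ w b0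
  (lt_le_trans ltr01 p1) A0 ksd a_gt0 d_l_bound) _.
rewrite mulrA ler_pdivrMr// mul1r.
have bp : b `^ p <= eps ^+ 2 / k%:R * (k%:R / eps ^+ 2) `^ u.
  have -> : b `^ p = (b ^+ 2) `^ (p / 2).
    by rewrite -powR_mulrn// -powRrM; congr (_ `^ _); field.
  have -> : eps ^+ 2 / k%:R * (k%:R / eps ^+ 2) `^ u = (eps ^+ 2 / k%:R) `^ (p / 2).
    have ek : 0 < eps ^+ 2 / k%:R by rewrite divr_gt0.
    have -> : k%:R / eps ^+ 2 = (eps ^+ 2 / k%:R)^-1 by rewrite invf_div.
    move: (eps ^+ 2 / k%:R) ek => z z0.
    rewrite -powR_inv1 ?ltW// -powRrM -[X in X * _]powRr1 ?ltW// -powRD; last first.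
      by rewrite (gt_eqF z0) implybT.
    by congr (_ `^ _); rewrite /u; field.
  have ph : 0 <= p / 2 by rewrite divr_ge0.
  rewrite (ge0_ler_powR ph) ?nnegrE ?sqr_ge0//; first by rewrite divr_ge0// ltW.
  by rewrite ler_pdivlMr// mulrC.
apply: (@le_trans _ _ (k%:R * (eps ^+ 2 / k%:R * (k%:R / eps ^+ 2) `^ u))).
  by rewrite ler_wpM2l// ltW.
rewrite mulrA [k%:R * _](_ : _ = eps ^+ 2); last by field; rewrite gt_eqF.
rewrite (_ : A = eps ^+ 2 * (n%:R `^ u * 192)) ?ler_pM2l//; last by rewrite /A; ring.
apply: (@le_trans _ _ ((192 ^+ 2 * n%:R) `^ u)).
  have u0 : 0 <= u by rewrite divr_ge0// subr_ge0.
  apply: (ge0_ler_powR u0); rewrite ?nnegrE.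
  - by rewrite divr_ge0// ltW.
  - by apply: mulr_ge0; [exact: sqr_ge0|exact: ler0n].
  - by rewrite ler_pdivrMr// -mulrA.
rewrite powRM ?sqr_ge0// mulrC; apply: ler_wpM2l; first exact: powR_ge0.
apply: (@le_trans _ _ ((192 ^+ 2) `^ (2^-1))).
  apply: ler_powR; first by apply: exprn_ege1; rewrite ler1n.
  rewrite /u ler_pdivrMr// mulVf// lerBlDr -lerBlDl.
  by rewrite (_ : 2 - 1 = 1 :> R)//; ring.
by rewrite powR12_sqrt ?sqr_ge0// sqrtr_sqr ger0_norm ?ler0n.
Qed.

End ellipsoid.

(** * Lower bounds on the sample sizes *)

Section lower_bounds.
Context {R : realType} (D : nat) (p : R) (a : 'I_D -> R) (eps : R) (n m : nat).
Variable psi : ((n + n + m) * D).-tuple R -> bool.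
Hypothesis p1 : 1 <= p.
Hypothesis p2 : p <= 2.
Hypothesis a_noninc : forall s t : 'I_D, (s <= t)%N -> a t <= a s.
Hypothesis a_gt0 : forall t : 'I_D, 0 < a t.
Hypothesis eps_gt0 : 0 < eps.
Hypothesis n_gt0 : (0 < n)%N.
Hypothesis psi_ok : lfht_test_ok (Gamma_set p a) eps psi.

Let eps2_gt0 : 0 < eps ^+ 2. Proof. by rewrite exprn_gt0. Qed.

Lemma test_errors (th1 th2 : 'I_D -> R) :
  Gamma_set p a th1 -> Gamma_set p a th2 ->
  eps ^+ 2 <= \sum_k (th1 k - th2 k) ^+ 2 ->
  error_le psi (lfht_mean n m th1 th2 th1) /\
  error_le (negb \o psi) (lfht_mean n m th1 th2 th2).
Proof.
move=> G1 G2 e12; have [mpsi /(_ th1 th2 G1 G2)[]] := psi_ok.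
  rewrite /norm2 -(ger0_norm (ltW eps_gt0)) -sqrtr_sqr ler_wsqrtr//.
move=> E0 E1; split.
  exact: gauss_mean_error E0.
apply: gauss_mean_error E1 => //.
rewrite (_ : [set t | ~~ psi t] = ~` [set t | psi t]); first exact: measurableC.
by apply/seteqP; split => t /= /negP.
Qed.

Lemma affinity_bound (x : R) : expR (- x / 8) <= 7 / 8 -> 1 <= x.
Proof. by have := expR_ge1Dx (- x / 8); lra. Qed.

Let dot_sub N (u v : nat -> R) :
  dot N (u \- v) (u \- v) = dot N u u - 2 * dot N u v + dot N v v.
Proof.
rewrite /dot mulr_sumr -sumrN -!big_split/=; apply: eq_bigr => i _.
by ring.
Qed.

(** An admissible pair keeps the test condition from being vacuous; shrinking it by [eps / d] makes
    its distance exactly [eps]. Comparing (th1, th2, th1) with (th1, th2, th2) gives the bound on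
    [m], and with (th2, th1, th1) the one on [n]. *)
Lemma pair_bounds :
  (exists th1 th2 : 'I_D -> R, Gamma_set p a th1 /\ Gamma_set p a th2 /\
     eps <= norm2 (fun k => th1 k - th2 k)) ->
  1 <= m%:R * eps ^+ 2 /\ 1 <= 2 * (n%:R * eps ^+ 2).
Proof.
move=> [t1 [t2 [G1 [G2 e12]]]].
set d := norm2 _ in e12; have d0 : 0 < d := lt_le_trans eps_gt0 e12.
have r1 : `|eps / d| <= 1.
  by rewrite (ger0_norm (divr_ge0 (ltW eps_gt0) (ltW d0))) ler_pdivrMr// mul1r.
pose th1 k := eps / d * t1 k; pose th2 k := eps / d * t2 k.
have {}G1 : Gamma_set p a th1 by exact: Gamma_setZ.
have {}G2 : Gamma_set p a th2 by exact: Gamma_setZ.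
have dE : \sum_k (th1 k - th2 k) ^+ 2 = eps ^+ 2.
  transitivity ((eps / d) ^+ 2 * d ^+ 2); last by field; rewrite gt_eqF.
  have -> : d ^+ 2 = \sum_k (t1 k - t2 k) ^+ 2.
    by rewrite sqr_sqrtr//; apply: sumr_ge0 => k _; exact: sqr_ge0.
  by rewrite mulr_sumr; apply: eq_bigr => k _; rewrite -exprMn mulrBr.
have dE' : \sum_k (th2 k - th1 k) ^+ 2 = eps ^+ 2.
  by rewrite -dE; apply: eq_bigr => k _; ring.
have [E0 E1] := test_errors G1 G2 (eq_ind_r (fun x => eps ^+ 2 <= x) (lexx _) dE).
have [_ E2] := test_errors G2 G1 (eq_ind_r (fun x => eps ^+ 2 <= x) (lexx _) dE').
have sE : \sum_k (th1 k - th2 k) ^+ 2 = \sum_k th1 k * th1 k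
    - 2 * (\sum_k th1 k * th2 k) + \sum_k th2 k * th2 k.
  by rewrite mulr_sumr -sumrN -!big_split/=; apply: eq_bigr => k _; ring.
have sC : \sum_k th2 k * th1 k = \sum_k th1 k * th2 k.
  by apply: eq_bigr => k _; rewrite mulrC.
split; apply: affinity_bound.
  apply: le_trans (two_point_affinity E0 E1).
  rewrite dot_sub !dot_lfht_mean -dE sE ?sC le_eqVlt; apply/orP; left; apply/eqP.
  by congr expR; field.
apply: le_trans (two_point_affinity E0 E2).
rewrite dot_sub !dot_lfht_mean -dE sE ?sC le_eqVlt; apply/orP; left; apply/eqP.
by congr expR; field.
Qed.

(** The choice of [ga] encodes theta = theta1 under H0 and theta = theta2 under H1. *)
Lemma sparse_test_bound (k s : nat) (b : R) (al be : bool -> R) (z z' : R) :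
  (0 < k)%N -> (0 < s)%N -> (k * s <= d_l p a n eps)%N ->
  k%:R <= 192 ^+ 2 * (n%:R * eps ^+ 2) -> 0 <= b -> k%:R * b ^+ 2 <= eps ^+ 2 ->
  (forall e, `|al e| <= 1) -> (forall e, `|be e| <= 1) ->
  (forall e, eps ^+ 2 <= (al e - be e) ^+ 2 * (k%:R * b ^+ 2)) ->
  let ga e := if e then be e else al e in
  let c e e' := n%:R * (al e * al e') + n%:R * (be e * be e')
                + m%:R * (ga e * ga e') in
  c false false = z -> c true true = z -> c false true = z' ->
  s%:R <= 4 * k%:R * expR (z * b ^+ 2 / 2) * (hcos (z * b ^+ 2) - hcos (z' * b ^+ 2)).
Proof.
move=> k0 s0 ksd kx b0 kb al1 be1 eps_le ga c z00 z11 z01.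
have ksD : (k * s <= D)%N := leq_trans ksd (d_l_le n p eps a).
have err (w : 'I_k -> 'I_s * bool) e := test_errors
  (Gamma_setZ p1 (al1 e) (Gamma_spike p1 p2 a_noninc a_gt0 eps_gt0 n_gt0 w k0 ksd kx b0 kb))
  (Gamma_setZ p1 (be1 e) (Gamma_spike p1 p2 a_noninc a_gt0 eps_gt0 n_gt0 w k0 ksd kx b0 kb)).
have dist (w : 'I_k -> 'I_s * bool) e :
    eps ^+ 2 <= \sum_(t < D) (al e * spike b w t - be e * spike b w t) ^+ 2.
  under eq_bigr do rewrite -mulrBl exprMn.
  by rewrite -mulr_sumr (sum_spike2 b ksD).
apply: (@sparse_bound R D n m k s b al be ga psi ksD s0 z z') => //.
  by move=> w; have [] := err w false (dist w false).
by move=> w; have [] := err w true (dist w true).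
Qed.

Let d := d_l p a n eps.
Let x := n%:R * eps ^+ 2.
Let y := m%:R * eps ^+ 2.

Let hcos0 : hcos 0 = 1 :> R.
Proof. by rewrite /hcos oppr0 expR0; field. Qed.

(* From (0, v, 0) against (v, 0, 0), where the k nonzero entries of v are
   +-sqrt (eps ^+ 2 / k). *)
Lemma one_sided_bound (k s : nat) :
  (0 < k)%N -> (0 < s)%N -> (k * s <= d)%N ->
  k%:R <= 192 ^+ 2 * x -> 8 * x <= 3 * k%:R ->
  k%:R * s%:R <= 388 / 100 * x ^+ 2.
Proof.
move=> k0 s0 ksd kx xk; have kp : 0 < k%:R :> R by rewrite ltr0n.
have x0 : 0 <= x by rewrite mulr_ge0// ltW.
pose b := Num.sqrt (eps ^+ 2 / k%:R).
have b2 : b ^+ 2 = eps ^+ 2 / k%:R by rewrite sqr_sqrtr// divr_ge0// ltW.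
have kb : k%:R * b ^+ 2 = eps ^+ 2 by rewrite b2; field; rewrite gt_eqF.
have kb_le : k%:R * b ^+ 2 <= eps ^+ 2 by rewrite kb.
have := @sparse_test_bound k s b (fun e => if e then 1 else 0)
  (fun e => if e then 0 else 1) n%:R 0 k0 s0 ksd kx (sqrtr_ge0 _) kb_le.
rewrite kb mul0r hcos0 b2 (_ : n%:R * (eps ^+ 2 / k%:R) = x / k%:R); last first.
  by rewrite mulrA.
move=> H; have {}H : s%:R <= 4 * k%:R * expR (x / k%:R / 2) * (hcos (x / k%:R) - 1).
  apply: H.
  - by case; rewrite ?normr0 ?normr1.
  - by case; rewrite ?normr0 ?normr1.
  - by case; rewrite ?subr0 ?sub0r ?sqrrN expr1n mul1r.
  - by ring.
  - by ring.
  - by ring.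
have y0 : 0 <= x / k%:R by rewrite divr_ge0// ltW.
have y1 : x / k%:R <= 3 / 8 by rewrite ler_pdivrMr//; lra.
have kk4 : 0 < 4 * (k%:R * k%:R) :> R by rewrite !mulr_gt0.
rewrite -(ler_pM2l kp) in H; apply: le_trans H _.
(* The constant 388/100 is 4 times 97/100. *)
apply: (@le_trans _ _ (4 * (k%:R * k%:R) * (97 / 100 * (x / k%:R) ^+ 2))).
  apply: le_trans (ler_wpM2l (ltW kk4) (hcos_sub1_le y0 y1)).
  by rewrite le_eqVlt; apply/orP; left; apply/eqP; ring.
by rewrite le_eqVlt; apply/orP; left; apply/eqP; field; rewrite gt_eqF.
Qed.

(* From (v, -v, v) against (v, -v, -v), where the k nonzero entries of v are
   +-sqrt (eps ^+ 2 / (4 k)). *)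
Lemma two_sided_bound (k s : nat) :
  (0 < k)%N -> (0 < s)%N -> (k * s <= d)%N ->
  k%:R <= 192 ^+ 2 * x -> x <= k%:R -> 24 * y <= x ->
  k%:R * s%:R <= 54 / 10 * (x * y).
Proof.
move=> k0 s0 ksd kx xk yx; have kp : 0 < k%:R :> R by rewrite ltr0n.
have x0 : 0 <= x by rewrite mulr_ge0// ltW.
have y0 : 0 <= y by rewrite mulr_ge0// ltW.
pose b := Num.sqrt (eps ^+ 2 / (4 * k%:R)).
have b2 : b ^+ 2 = eps ^+ 2 / (4 * k%:R).
  by rewrite sqr_sqrtr// divr_ge0 ?mulr_ge0// ltW.
have kb : k%:R * b ^+ 2 = eps ^+ 2 / 4 by rewrite b2; field; rewrite gt_eqF.
have kb_le : k%:R * b ^+ 2 <= eps ^+ 2 by rewrite kb; move: eps2_gt0; lra.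
have := @sparse_test_bound k s b (fun=> 1) (fun=> -1)
  (2 * n%:R + m%:R) (2 * n%:R - m%:R) k0 s0 ksd kx (sqrtr_ge0 _) kb_le.
set P := x / (2 * k%:R); set M := y / (4 * k%:R).
rewrite kb b2 (_ : (2 * n%:R + m%:R) * _ = P + M); last first.
  by rewrite /P /M /x /y; field; rewrite gt_eqF.
rewrite (_ : (2 * n%:R - m%:R) * _ = P - M); last first.
  by rewrite /P /M /x /y; field; rewrite gt_eqF.
move=> H; have {}H : s%:R <= 4 * k%:R * expR ((P + M) / 2) * (hcos (P + M) - hcos (P - M)).
  apply: H.
  - by move=> _; rewrite normr1.
  - by move=> _; rewrite normrN1.
  - by move=> _; rewrite (_ : (1 - -1) ^+ 2 * (eps ^+ 2 / 4) = eps ^+ 2)//; field.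
  - by ring.
  - by ring.
  - by ring.
have k2 : 0 < 2 * k%:R :> R by rewrite mulr_gt0.
have k4 : 0 < 4 * k%:R :> R by rewrite mulr_gt0.
have P0 : 0 <= P by rewrite divr_ge0// ltW.
have M0 : 0 <= M by rewrite divr_ge0// ltW.
have P1 : P <= 1 / 2 by rewrite ler_pdivrMr//; lra.
have M1 : M <= 1 / 96 by rewrite ler_pdivrMr//; lra.
have M2 : M <= 1 / 2 by lra.
have hc := hcos_addB_le P0 P1 M0 M2.
(* [(P + M) / 2] is at most 49/192, and 192/143 < 135/100. *)
have eb : expR ((P + M) / 2) <= 135 / 100.
  apply: le_trans (@expR_le_inv _ ((P + M) / 2) _) _; first lra.
  by rewrite -[leRHS]invrK lef_pV2 ?posrE; lra.
have e0 := expR_ge0 ((P + M) / 2).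
have H1 : s%:R <= 4 * k%:R * (135 / 100 * (8 * (P * M))).
  apply: le_trans H _; rewrite -mulrA ler_pM2l//.
  have PM0 : 0 <= 8 * (P * M) by apply: mulr_ge0 => //; exact: mulr_ge0.
  apply: le_trans (ler_wpM2l e0 hc) _.
  by rewrite ler_wpM2r.
rewrite -(ler_pM2l kp) in H1; apply: le_trans H1 _.
rewrite le_eqVlt; apply/orP; left; apply/eqP.
by rewrite /P /M; field; rewrite gt_eqF.
Qed.

Let truncn_block (r : R) : 0 <= r -> exists k : nat,
  [/\ (0 < k)%N, r <= k%:R & k%:R <= r + 1].
Proof.
move=> r0; exists (Num.truncn r).+1; split=> //.
  by apply: ltW; rewrite truncnS_gt.
by rewrite -natr1 lerD2r truncn_le.
Qed.

(** Blocks of length [d %/ k] leave fewer than [k] coordinates uncovered. *)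
Let block_cover (k : nat) : (0 < k)%N -> (k <= d)%N ->
  [/\ (0 < d %/ k)%N, (k * (d %/ k) <= d)%N &
      d%:R <= k%:R * (d %/ k)%:R + k%:R :> R].
Proof.
move=> k0 kd; split; first by rewrite divn_gt0.
  by rewrite mulnC leq_trunc_div.
rewrite -natrM -natrD ler_nat mulnC -mulSnr.
exact/ltnW/ltn_ceil.
Qed.

Let K384 : 384 <= 192 ^+ 2 :> R.
Proof.
have -> : 384 = 2 * 192 :> R by rewrite -natrM.
by rewrite expr2 ler_pM2r ?ltr0n// ler_nat.
Qed.

Lemma dim_le_n : 1 <= 2 * x -> d%:R <= 4 * x ^+ 2.
Proof.
move=> x1; rewrite leNgt; apply/negP => dx.
have x0 : 0 <= x by lra.
(* [d] is an integer above 4 x^2 >= 1. This rules out 3 d < 8 x below, which would force x < 2/3 and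
   d < 16/9. *)
have d1 : (1 < d)%N by rewrite -(ltr_nat R); nra.
have d2 : 2 <= d%:R :> R by rewrite ler_nat.
(* If membership in Gamma allows it, every coordinate is its own block; otherwise [k] is an integer
   between 4 x and 4 x + 1. *)
have [dK|dK] := leP d%:R (192 ^+ 2 * x).
  have := @one_sided_bound d 1 (ltnW d1) isT.
  rewrite muln1 mulr1 leqnn dK => /(_ isT isT) H.
  have : 8 * x <= 3 * d%:R.
    by rewrite leNgt; apply/negP => ?; nra.
  move=> /H; nra.
have [k [k0 xk kx]] := @truncn_block (4 * x) ltac:(lra).
have xd : 384 * x <= d%:R by apply: le_trans (ltW dK); rewrite ler_wpM2r.
have kd : (k <= d)%N by rewrite -(ler_nat R); lra.
have [s0 ksd sd] := block_cover k0 kd.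
have kK : k%:R <= 192 ^+ 2 * x.
  by apply: (@le_trans _ _ (384 * x)); [lra|rewrite ler_wpM2r].
(* Contradiction with d <= 388/100 x^2 + 4 x + 1: 97/100 of d exceeds the quadratic term, and the
   other 3/100, at least 11 x, exceeds the rounding loss. *)
have := one_sided_bound k0 s0 ksd kK ltac:(lra).
lra.
Qed.

Lemma dim_le_mn : 1 <= y -> 1 <= 2 * x -> d%:R <= 4 * x ^+ 2 ->
  d%:R <= 96 * (x * y).
Proof.
move=> y1 x1 dx; rewrite leNgt; apply/negP => dxy.
have x0 : 0 < x by lra.
(* From 96 x y < d <= 4 x^2. *)
have yx : 24 * y <= x by rewrite leNgt; apply/negP => ?; nra.
have xd : 96 * x <= d%:R by nra.
have [k [k0 xk kx]] := @truncn_block x (ltW x0).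
have kd : (k <= d)%N by rewrite -(ler_nat R); lra.
have [s0 ksd sd] := block_cover k0 kd.
have kK : k%:R <= 192 ^+ 2 * x.
  by apply: (@le_trans _ _ (384 * x)); [lra|rewrite ler_wpM2r// ltW].
(* This gives d <= 54/10 x y + x + 1, far below 96 x y since y >= 1 and 2 x >= 1. *)
have := two_sided_bound k0 s0 ksd kK xk yx.
nra.
Qed.

End lower_bounds.

Theorem mainTheorem9 (R : realType) (D : nat) (p : R) (a : 'I_D -> R)
    (eps : R) (n m : nat) (psi : ((n + n + m) * D).-tuple R -> bool) :
  (0 < D)%N -> 1 <= p -> p <= 2 ->
  (forall s t : 'I_D, (s <= t)%N -> a t <= a s) ->
  (forall t : 'I_D, 0 < a t) ->
  0 < eps -> (0 < n)%N ->
  (exists th1 th2 : 'I_D -> R, Gamma_set p a th1 /\ Gamma_set p a th2 /\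
     eps <= norm2 (fun k => th1 k - th2 k)) ->
  lfht_test_ok (Gamma_set p a) eps psi ->
  [/\ 1 / eps ^+ 2 <= m%:R,
      Num.sqrt (d_l p a n eps)%:R / (2 * eps ^+ 2) <= n%:R &
      (d_l p a n eps)%:R / (96 * eps ^+ 4) <= (m * n)%:R].
Proof.
move=> _ p1 p2 a_noninc a_gt0 eps_gt0 n_gt0 pair psi_ok.
have e2 : 0 < eps ^+ 2 by rewrite exprn_gt0.
have [my nx] := pair_bounds p1 eps_gt0 psi_ok pair.
have dn := dim_le_n p1 p2 a_noninc a_gt0 eps_gt0 n_gt0 psi_ok nx.
have dmn := dim_le_mn p1 p2 a_noninc a_gt0 eps_gt0 n_gt0 psi_ok my nx dn.
split.
- by rewrite ler_pdivrMr.
- rewrite ler_pdivrMr ?mulr_gt0//.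
  have x0 : 0 <= n%:R * (2 * eps ^+ 2) by rewrite !mulr_ge0// ltW.
  rewrite -(ger0_norm x0) -sqrtr_sqr ler_wsqrtr//; apply: le_trans dn _.
  by rewrite le_eqVlt; apply/orP; left; apply/eqP; ring.
- rewrite ler_pdivrMr ?mulr_gt0 ?exprn_gt0//; apply: le_trans dmn _.
  by rewrite natrM le_eqVlt; apply/orP; left; apply/eqP; ring.
Qed.
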